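(* Let $N\ge 2$, let $\mathcal{U}\subseteq\{0,1,\dots,N-1\}^{\mathbb{Z}^2}$ be an additive shift space, and let $\Omega=\{\Omega(n)\}_{n=1}^{\infty}$ be an expanding system of $\mathbb{Z}^2$. For each $n$ let $\Omega'(n)$ denote the complement of $\Omega(n)$ in the smallest rectangular lattice containing $\Omega(n)$. If $$\limsup_{n\to\infty}\frac{|\partial\Omega(n)|}{|\Omega(n)|}=0,$$ then $h_{\Omega}(\mathcal{U})\le h_r(\mathcal{U})$. Furthermore, if in addition $$\sup\left\{\frac{|\Omega'(n)|}{|\Omega(n)|}: n\ge 1\right\}<\infty,$$ then $h_{\Omega}(\mathcal{U})=h_r(\mathcal{U})$.
   Context: Let $\mathcal{A}=\{0,1,\dots,N-1\}$ with $N\ge2$. An additive shift space $\mathcal{U}\subseteq\mathcal{A}^{\mathbb{Z}^2}$ is a subset that is closed (in the product topology) and invariant under all shifts $\sigma^{\mathbf{v}}$, $\mathbf{v}\in\mathbb{Z}^2$, where $(\sigma^{\mathbf{v}}(x))_{i,j}=x_{(i,j)+\mathbf{v}}$. An expanding system $\Omega=\{\Omega(n)\}_{n=1}^\infty$ of $\mathbb{Z}^2$ is a sequence of finite nonempty subsets $\Omega(n)\subset\mathbb{Z}^2$ with $\Omega(n)\subseteq\Omega(n+1)$ for all $n$ and $\bigcup_{n\ge1}\Omega(n)=\mathbb{Z}^2$. For finite $\mathbb{L}\subset\mathbb{Z}^2$ let $\Gamma(\mathbb{L},\mathcal{U})=|\{x|_{\mathbb{L}}: x\in\mathcal{U}\}|$,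 and $$h_\Omega(\mathcal{U})=\limsup_{n\to\infty}\frac{1}{|\Omega(n)|}\log\Gamma(\Omega(n),\mathcal{U}).$$ For $m,n\ge1$ and $(i,j)\in\mathbb{Z}^2$, the $m\times n$ rectangular lattice is $\mathbb{Z}_{m\times n}((i,j))=\{(i+n_1,j+n_2):0\le n_1\le m-1,\ 0\le n_2\le n-1\}$, and $\mathbb{Z}_{m\times n}=\mathbb{Z}_{m\times n}((0,0))$. The rectangular entropy is $$h_r(\mathcal{U})=\limsup_{m,n\to\infty}\frac{1}{mn}\log\Gamma(\mathbb{Z}_{m\times n},\mathcal{U})$$ (the limit exists and equals $\inf_{m,n\ge1}\frac1{mn}\log\Gamma(\mathbb{Z}_{m\times n},\mathcal{U})$). For finite $\mathbb{L}\subset\mathbb{Z}^2$, the interior is $\overset{\circ}{\mathbb{L}}=\{(i,j)\in\mathbb{L}: (i+1,j),(i,j+1),(i+1,j+1)\in\mathbb{L}\}$ and the boundary is $\partial\mathbb{L}=\mathbb{L}\setminus\overset{\circ}{\mathbb{L}}$. *)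

(* Defs.v *)
From HB Require Import structures.
From mathcomp Require Import all_boot all_order all_algebra finmap zify.
From mathcomp Require Import all_classical all_reals all_analysis.

Set Implicit Arguments.
Unset Strict Implicit.
Unset Printing Implicit Defensive.
Import Order.TTheory GRing.Theory Num.Theory.
Local Open Scope classical_set_scope.
Local Open Scope ring_scope.

Notation Z2 := (int * int)%type.

(* A^(Z^2) with the product topology, A = {0, ..., N-1} being discrete. *)
Notation config N := {ptws Z2 -> discrete_topology 'I_N}.

Definition shift (N : nat) (v : Z2) (x : config N) : config N :=
  fun w => x (w + v).

Definition additive_shift_space (N : nat) (U : set (config N)) : Prop :=
  closed U /\ forall v : Z2, @shift N v @` U `<=` U.

(* Sequences are indexed from 1: the value Omega 0 is unconstrained. *)
Definition expanding_system (Omega : nat -> {fset Z2}) : Prop :=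
  [/\ forall n, (1 <= n)%N -> Omega n != fset0,
      forall n, (1 <= n)%N -> (Omega n `<=` Omega n.+1)%fset &
      forall v : Z2, exists2 n, (1 <= n)%N & v \in Omega n].

Definition restr (N : nat) (L : {fset Z2}) (x : config N) : {ffun L -> 'I_N} :=
  [ffun w => x (val w)].

Definition Gamma (N : nat) (L : {fset Z2}) (U : set (config N)) : nat :=
  #|[pred p : {ffun L -> 'I_N} | `[< (@restr N L @` U) p >]]|.

(* Extended-real valued, so that for U = set0, where Gamma = 0, the logarithm
   and both entropies are -oo. *)
Definition log_density (R : realType) (N : nat) (U : set (config N))
    (L : {fset Z2}) : \bar R :=
  ((#|` L|%:R)^-1%:E * lne (Gamma L U)%:R%:E)%E.

Definition entropy (R : realType) (N : nat) (Omega : nat -> {fset Z2})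
    (U : set (config N)) : \bar R :=
  limn_esup (fun n => log_density R U (Omega n)).

Definition rect (m n : nat) (v : Z2) : {fset Z2} :=
  [fset (v.1 + i%:Z, v.2 + j%:Z)%R | i in iota 0 m, j in iota 0 n]%fset.

(* The limit superior is along m, n -> oo jointly: the product filter on
   nat * nat is generated by the sets {(m, n) | k <= m, n}. *)
Definition rect_entropy (R : realType) (N : nat) (U : set (config N))
    : \bar R :=
  limf_esup (fun p : nat * nat =>
      ((p.1 * p.2)%:R^-1%:E * lne (Gamma (rect p.1 p.2 (0, 0)) U)%:R%:E)%E)
    (filter_prod \oo \oo).

Definition lattice_interior (L : {fset Z2}) : {fset Z2} :=
  [fset v in L | [&& (v.1 + 1, v.2) \in L, (v.1, v.2 + 1) \in L
                   & (v.1 + 1, v.2 + 1) \in L]%R]%fset.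

Definition lattice_boundary (L : {fset Z2}) : {fset Z2} :=
  (L `\` lattice_interior L)%fset.

Definition is_rect (Q : {fset Z2}) : Prop :=
  exists m n v, [/\ (1 <= m)%N, (1 <= n)%N & Q = rect m n v].

Definition smallest_rect (L Q : {fset Z2}) : Prop :=
  [/\ is_rect Q, (L `<=` Q)%fset
    & forall Q', is_rect Q' -> (L `<=` Q')%fset -> (Q `<=` Q')%fset].

Definition rect_hull (L : {fset Z2}) : {fset Z2} :=
  xget fset0 [set Q | smallest_rect L Q].

Definition rect_compl (L : {fset Z2}) : {fset Z2} := (rect_hull L `\` L)%fset.

Lemma in_rect m n (v w : Z2) :
  (w \in rect m n v) =
  [&& v.1 <= w.1, w.1 < v.1 + m%:Z, v.2 <= w.2 & w.2 < v.2 + n%:Z].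
Proof.
apply/imfset2P/idP => [[i /= + [j /= + ->]]|/and4P[v1 w1 v2 w2]] /=.
  by rewrite !mem_iota !add0n => /andP[_ im] /andP[_ jn]; lia.
exists `|w.1 - v.1|%N; first by rewrite /= mem_iota; lia.
exists `|w.2 - v.2|%N; first by rewrite /= mem_iota; lia.
by case: w v1 w1 v2 w2 => a b /= *; congr pair; lia.
Qed.

Lemma rect_hullP L : L != fset0 -> smallest_rect L (rect_hull L).
Proof.
case/fset0Pn => w0 w0L; apply: (@xgetPex _ fset0 [set Q | smallest_rect L Q]).
pose z : L := [` w0L]%fset.
have [a _ amin] := @Order.TotalTheory.arg_minP _ _ L z predT (fun w => (val w).1) isT.
have [b _ bmax] := @Order.TotalTheory.arg_maxP _ _ L z predT (fun w => (val w).1) isT.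
have [c _ cmin] := @Order.TotalTheory.arg_minP _ _ L z predT (fun w => (val w).2) isT.
have [d _ dmax] := @Order.TotalTheory.arg_maxP _ _ L z predT (fun w => (val w).2) isT.
exists (rect (`|(val b).1 - (val a).1|.+1) (`|(val d).2 - (val c).2|.+1)
             ((val a).1, (val c).2)); split.
- by eexists; eexists; eexists; split; last reflexivity.
- apply/fsubsetP => w wL; rewrite in_rect /=.
  have /= := (amin [` wL]%fset isT, bmax [` wL]%fset isT,
              cmin [` wL]%fset isT, dmax [` wL]%fset isT).
  by move=> [[[]]]; lia.
- move=> _ [m [n [v [_ _ ->]]]] /fsubsetP LQ; apply/fsubsetP => w.
  have := (amin b isT, cmin d isT).
  have := (LQ _ (valP a), LQ _ (valP b), LQ _ (valP c), LQ _ (valP d)).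
  by rewrite !in_rect /= => -[[[/and4P[? ? ? ?] /and4P[? ? ? ?]]
    /and4P[? ? ? ?]] /and4P[? ? ? ?]] [? ?]; lia.
Qed.

(* Main.v *)
(* Count patterns by tiling.  Let perimeter L be the number of points of L moved
   out of L by (1, 0), plus the number moved out by (0, 1).  Counting shows that
   opposite translations move out equally many points, so any u moves out at
   most max(|u.1|, |u.2|) * perimeter L points.  Hence, for the tiling of Z^2 by
   translates of an a x b rectangle Q, all but O(perimeter L) points of L lie in
   tiles contained in L, and
     log Gamma L <= |L| / |Q| * log Gamma Q + O(perimeter L).
   Since perimeter L <= 2 |boundary L|, this gives h_Omega <= r, where r is the
   infimum of log Gamma Q / |Q| over rectangles; applied to large rectangles it
   gives h_r = r.  For the converse inequality, let H be the hull of Omega n and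
   O' = H \ Omega n.  Then
     r |H| <= log Gamma H <= log Gamma (Omega n) + log Gamma O',
   perimeter O' <= perimeter H + perimeter (Omega n) = o(|Omega n|), and tiling
   O' by a rectangle of density close to r bounds log Gamma O' by
   (r + small) |O'| + o(|Omega n|), where |O'| = O(|Omega n|). *)

Require Import Defs.
From HB Require Import structures.
From mathcomp Require Import all_boot all_order all_algebra finmap.
From mathcomp Require Import all_classical all_reals all_analysis.
From mathcomp Require Import zify ring lra.

Set Implicit Arguments.
Unset Strict Implicit.
Unset Printing Implicit Defensive.
Import Order.TTheory GRing.Theory Num.Theory.
Local Open Scope classical_set_scope.
Local Open Scope ring_scope.

(** * Counting patterns and submultiplicativity *)

Section Patterns.
Variables (N : nat) (U : set (config N)).

Lemma eq_restrP (L : {fset Z2}) (x y : config N) :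
  restr L x = restr L y <-> {in L, x =1 y}.
Proof.
split=> [/ffunP xy w wL|xy]; first by have := xy [` wL]%fset; rewrite !ffunE.
by apply/ffunP => w; rewrite !ffunE xy// (valP w).
Qed.

(** Every bound on [Gamma] by a product or by another [Gamma] comes from a code [f] that determines
    the pattern on [L]: coding one chosen extension of each pattern is then injective. *)
Lemma Gamma_le (T : finType) (S : {pred T}) (L : {fset Z2})
    (f : config N -> T) :
  (forall x, U x -> f x \in S) ->
  (forall x y, U x -> U y -> f x = f y -> restr L x = restr L y) ->
  (Gamma L U <= #|S|)%N.
Proof.
move=> fS finj; rewrite /Gamma.
set P := [pred p | _].
pose ex (p : {ffun L -> 'I_N}) : config N -> Prop := fun x => U x /\ restr L x = p.
have exP p : p \in P -> {x | ex p x}.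
  by move=> /asboolP pU; apply: cid; case: pU => x Ux xp; exists x.
(* The option type makes [g] total without a default element of [T]; on [P] the value is always a
   [Some]. *)
pose g p := if pselect (p \in P) is left pP then Some (f (sval (exP p pP))) else None.
have gP p : p \in P -> exists x, [/\ U x, restr L x = p & g p = Some (f x)].
  move=> pP; rewrite /g; case: pselect => // pP'.
  by case: (exP p pP') => x [Ux xp]; exists x.
have gi : {in P &, injective g}.
  move=> p q /gP[x [Ux <- ->]] /gP[y [Uy <- ->]] [fxy].
  exact: finj.
have Si : injective (@Some T) by move=> ? ? [].
rewrite -(fintype.card_in_image gi) -(fintype.card_image Si).
apply/subset_leq_card/fintype.subsetP => _ /fintype.imageP[p /gP[x [Ux _ ->]] ->].
by apply/fintype.imageP; exists (f x) => //; exact: fS.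
Qed.

Lemma restr_in_Gamma (L : {fset Z2}) x : U x ->
  restr L x \in [pred p : {ffun L -> 'I_N} | `[< (@restr N L @` U) p >]].
Proof. by move=> Ux; apply/asboolP; exists x. Qed.

Lemma GammaU (L1 L2 : {fset Z2}) :
  (Gamma (L1 `|` L2)%fset U <= Gamma L1 U * Gamma L2 U)%N.
Proof.
rewrite /Gamma -cardX.
apply: (@Gamma_le _ _ _ (fun x => (restr L1 x, restr L2 x))) => [x Ux|x y _ _].
  by rewrite inE; apply/andP; split; exact: restr_in_Gamma.
move=> [/eq_restrP xy1 /eq_restrP xy2]; apply/eq_restrP => w.
by rewrite in_fsetU => /orP[/xy1|/xy2].
Qed.

Lemma Gamma_le_exp (L : {fset Z2}) : (Gamma L U <= N ^ #|` L|)%N.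
Proof.
apply: (leq_trans (max_card _)).
by rewrite card_ffun card_ord -cardfE.
Qed.

Lemma Gamma_gt0 (L : {fset Z2}) : U !=set0 -> (0 < Gamma L U)%N.
Proof.
by move=> [x Ux]; apply/card_gt0P; exists (restr L x); exact: restr_in_Gamma.
Qed.

Lemma Gamma_set0 (L : {fset Z2}) : Gamma L (@set0 (config N)) = 0%N.
Proof.
by apply: eq_card0 => p; apply/negbTE/asboolPn => -[].
Qed.

Hypothesis shiftU : forall v : Z2, @Defs.shift N v @` U `<=` U.

(** Shifting by [v - w] stays in [U] and moves what is seen on the rectangle at [v] to the one at
    [w]. As [v] and [w] are arbitrary, equality follows. *)
Lemma Gamma_rect_le m n (v w : Z2) :
  (Gamma (rect m n v) U <= Gamma (rect m n w) U)%N.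
Proof.
apply: (@Gamma_le _ _ _ (fun x => restr (rect m n w) (Defs.shift (v - w) x))).
  by move=> x Ux; apply/restr_in_Gamma/shiftU; exists x.
move=> x y _ _ /eq_restrP xy; apply/eq_restrP => z zv.
have := xy (z - (v - w)); rewrite /Defs.shift subrK; apply.
by move: z v w zv {xy} => [z1 z2] [v1 v2] [w1 w2]; rewrite !in_rect /=; lia.
Qed.

End Patterns.

(** * Points moved out of a finite set by a translation *)

Section Escape.

Lemma addZ2E (u v : Z2) : u + v = (u.1 + v.1, u.2 + v.2).
Proof. by []. Qed.

Definition escape (L : {fset Z2}) (u : Z2) : {fset Z2} :=
  [fset w in L | (w + u)%R \notin L]%fset.

Definition perimeter (L : {fset Z2}) : nat :=
  (#|` escape L (1, 0)%R| + #|` escape L (0, 1)%R|)%N.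

Lemma card_translate (L : {fset Z2}) (u : Z2) :
  #|` [fset (w + u)%R | w in L]%fset| = #|` L|.
Proof. by rewrite card_imfset//; exact: addIr. Qed.

(** Translation by [u] is a bijection from the points of [L] that stay in [L] under [u] onto those
    that stay under [- u]; the complements in [L] are therefore equinumerous. *)
Lemma escapeN (L : {fset Z2}) (u : Z2) : #|` escape L (- u)%R| = #|` escape L u|.
Proof.
have e v : (#|` escape L v| = #|` L| - #|` [fset w in L | (w + v)%R \in L]%fset|)%N.
  rewrite -cardfsDS; last by apply/fsubsetP => w; rewrite !inE => /andP[].
  congr #|` _|; apply/fsetP => w; rewrite !inE.
  by case: (w \in L) => //=; rewrite andbT.
rewrite !e -(card_translate [fset w in L | _]%fset (- u)); congr (_ - #|` _|)%N.
apply/fsetP => w; apply/imfsetP/idP => /= [[z + ->]|].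
  by rewrite !inE subrK => /andP[-> ->].
rewrite !inE => /andP[wL wuL]; exists (w + u); last by rewrite addrK.
by rewrite !inE addrK wL wuL.
Qed.

(** A point leaving under [u + v] either leaves under [u], or arrives by [u] at a point of [L] that
    leaves under [v]. *)
Lemma escapeD (L : {fset Z2}) (u v : Z2) :
  (#|` escape L (u + v)%R| <= #|` escape L u| + #|` escape L v|)%N.
Proof.
rewrite -(card_translate (escape L v) (- u)).
apply: (@leq_trans #|` escape L u `|` [fset (w - u)%R | w in escape L v]|%fset).
  apply/fsubset_leq_card/fsubsetP => w; rewrite in_fsetU !inE => /andP[wL wuv].
  rewrite wL /=; case: (boolP (w + u \in L)) => //= wuL.
  apply/imfsetP; exists (w + u); last by rewrite addrK.
  by rewrite !inE wuL -addrA.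
by rewrite cardfsU leq_subr.
Qed.

Lemma escapeMn (L : {fset Z2}) (u : Z2) n :
  (#|` escape L (u *+ n)%R| <= n * #|` escape L u|)%N.
Proof.
elim: n => [|n IH].
  rewrite leqn0 cardfs_eq0; apply/eqP/fsetP => w.
  by rewrite !inE mulr0n addr0 andbN.
by rewrite mulrS mulSn (leq_trans (escapeD _ _ _))// leq_add2l.
Qed.

Lemma escapeMz (L : {fset Z2}) (u : Z2) (z : int) :
  (#|` escape L (u *~ z)%R| <= `|z| * #|` escape L u|)%N.
Proof.
case: z => n; first exact: escapeMn.
by rewrite NegzE mulrNz escapeN abszN; exact: escapeMn.
Qed.

Lemma escape_le_perimeter (L : {fset Z2}) (u : Z2) k :
  (`|u.1| <= k)%N -> (`|u.2| <= k)%N ->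
  (#|` escape L u| <= k * perimeter L)%N.
Proof.
move=> u1 u2.
(* Reach [u] by unit steps, [|u.1|] horizontal and [|u.2|] vertical, each costing at most one term
   of the perimeter. *)
have -> : u = (1, 0) *~ u.1 + (0, 1) *~ u.2.
  case: u {u1 u2} => a b /=.
  have mz (x y z : int) : ((x, y) : Z2) *~ z = (x * z, y * z).
    elim/int_ind: z => [|n IH|n IH].
    - by rewrite !mulr0 mulr0z.
    - by rewrite intS mulrzDr IH mulr1z !mulrDr !mulr1.
    - by rewrite intS opprD mulrzDr IH !mulrDr !mulrN !mulr1 mulrN1z.
  by rewrite !mz; congr pair; rewrite /=; lia.
rewrite (leq_trans (escapeD _ _ _))// mulnDr leq_add//.
  by rewrite (leq_trans (escapeMz _ _ _))// leq_mul2r u1 orbT.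
by rewrite (leq_trans (escapeMz _ _ _))// leq_mul2r u2 orbT.
Qed.

Lemma perimeter_le_boundary (L : {fset Z2}) :
  (perimeter L <= 2 * #|` lattice_boundary L|)%N.
Proof.
rewrite mul2n -addnn; apply: leq_add; apply/fsubset_leq_card/fsubsetP => w;
  rewrite !inE addZ2E /= addr0 => /andP[wL nL]; rewrite wL andbT /=;
  apply/negP => /and3P[]; first by rewrite (negbTE nL).
by move=> _; rewrite (negbTE nL).
Qed.

(** If [w] lies in the difference and [w + u] does not, then [w + u] is outside [L], or it is a
    point of [L'] that [- u] sends out of [L']; [escapeN] turns the latter count back to [u]. *)
Lemma escape_fsetD (L L' : {fset Z2}) (u : Z2) :
  (#|` escape (L `\` L')%fset u| <= #|` escape L u| + #|` escape L' u|)%N.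
Proof.
rewrite -(escapeN L') -(card_translate (escape L' _) (- u)).
apply: (@leq_trans #|` escape L u `|` [fset (w - u)%R | w in escape L' (- u)%R]|%fset);
  last by rewrite cardfsU leq_subr.
apply/fsubset_leq_card/fsubsetP => w; rewrite in_fsetU !inE.
move=> /andP[/andP[wL' wL]]; rewrite wL negb_and negbK /= orbC => /orP[->//|wuL'].
apply/orP; right; apply/imfsetP; exists (w + u); last by rewrite addrK.
by rewrite !inE addrK wuL' wL'.
Qed.

Lemma perimeter_fsetD (L L' : {fset Z2}) :
  (perimeter (L `\` L')%fset <= perimeter L + perimeter L')%N.
Proof. by rewrite /perimeter addnACA leq_add ?escape_fsetD. Qed.

Lemma card_rect m n v : #|` rect m n v| = (m * n)%N.
Proof.
have inj : injective (fun p : 'I_m * 'I_n => (v.1 + (p.1 : nat)%:Z, v.2 + (p.2 : nat)%:Z) : Z2).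
  by move=> [i j] [k l] /= [] e1 e2; congr pair; apply: val_inj => /=; lia.
transitivity #|{: 'I_m * 'I_n}|; last by rewrite card_prod !card_ord.
rewrite cardT -(size_map (fun p : 'I_m * 'I_n => (v.1 + (p.1 : nat)%:Z, v.2 + (p.2 : nat)%:Z) : Z2)).
apply: perm_size; apply: uniq_perm.
- exact: fset_uniq.
- by rewrite map_inj_uniq ?enum_uniq.
- move=> [a b]; rewrite in_rect /=.
  apply/idP/mapP => [/and4P[h1 h2 h3 h4]|[[i j] _ [-> ->]]] /=.
    have im : (`|a - v.1| < m)%N by lia.
    have jn : (`|b - v.2| < n)%N by lia.
    exists (Ordinal im, Ordinal jn); first by rewrite mem_enum.
    by congr pair => /=; lia.
  by have im := ltn_ord i; have jn := ltn_ord j; lia.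
Qed.

Lemma perimeter_rect m n v : (perimeter (rect m n v) <= m + n)%N.
Proof.
case: v => a b; rewrite addnC; apply: leq_add.
  (* Only the last column leaves under [(1, 0)], and only the last row under [(0, 1)]. *)
  rewrite -[leqRHS]mul1n -(card_rect 1 n (a + m%:Z - 1, b)).
  apply/fsubset_leq_card/fsubsetP => -[w1 w2]; rewrite !inE addZ2E !in_rect /=; lia.
rewrite -[leqRHS]muln1 -(card_rect m 1 (a, b + n%:Z - 1)).
apply/fsubset_leq_card/fsubsetP => -[w1 w2]; rewrite !inE addZ2E !in_rect /=; lia.
Qed.

End Escape.

(** * Tiling by translates of a rectangle *)

Section Tiling.
Variables (a b : nat).
Hypotheses (a0 : (0 < a)%N) (b0 : (0 < b)%N).

(** Division by a positive integer rounds down, also for negative coordinates, so the tiles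
    partition the whole plane. *)
Definition tile_index (w : Z2) : Z2 := ((w.1 %/ a)%Z, (w.2 %/ b)%Z).

Definition tile (t : Z2) : {fset Z2} := rect a b (t.1 * a%:Z, t.2 * b%:Z).

Lemma mem_tile t w : (w \in tile t) = (tile_index w == t).
Proof.
have eq_divz (x y : int) c : (0 < c)%N ->
    (x * c%:Z <= y) && (y < x * c%:Z + c%:Z) = ((y %/ c)%Z == x).
  move=> c0; rewrite -[X in _ < _ + X]mul1r -mulrDl -lez_divRL// -ltz_divLR//.
  by rewrite ltzD1 -eq_le eq_sym.
case: t w => [t1 t2] [w1 w2].
by rewrite in_rect andbA !eq_divz.
Qed.

(** Each added tile multiplies the count by at most that of one rectangle; tiles are disjoint, so
    their sizes add up exactly. *)
Lemma Gamma_tiles (N : nat) (U : set (config N)) (L : {fset Z2}) (s : seq Z2) :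
  (forall v : Z2, @Defs.shift N v @` U `<=` U) ->
  uniq s -> (forall t, t \in s -> tile t `<=` L)%fset ->
  let A := [fset w in L | tile_index w \in s]%fset in
  (Gamma A U <= Gamma (rect a b (0, 0)%R) U ^ size s)%N /\
  #|` A| = (size s * (a * b))%N.
Proof.
move=> shiftU; elim: s => [|t s IH] /=.
  move=> _ _; have -> : [fset w in L | tile_index w \in [::]]%fset = fset0.
    by apply/fsetP => w; rewrite !inE andbF.
  by split; [rewrite (leq_trans (Gamma_le_exp _ _))// cardfs0|rewrite cardfs0].
move=> /andP[ts us] tL.
have [u us'|IH1 IH2] := IH us; first by apply: tL; rewrite inE us' orbT.
set A := [fset w in L | tile_index w \in s]%fset in IH1 IH2 *.
have -> : [fset w in L | tile_index w \in t :: s]%fset = (tile t `|` A)%fset.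
  apply/fsetP => w; rewrite in_fsetU mem_tile !inE.
  have [/eqP wt|//] := boolP (tile_index w == t); rewrite andbT.
  by apply/(fsubsetP (tL t _)); rewrite ?mem_tile ?inE ?wt ?eqxx.
split.
  rewrite (leq_trans (GammaU _ _ _))// expnS leq_mul//.
  exact: Gamma_rect_le.
rewrite cardfsU (_ : tile t `&` A = fset0)%fset.
  by rewrite cardfs0 subn0 card_rect IH2 mulSn.
apply/fsetP => w; rewrite in_fsetI mem_tile !inE; apply/negbTE/negP.
by move=> /and3P[/eqP -> _]; exact/negP.
Qed.

Lemma card_has_escape (L : {fset Z2}) (s : seq Z2) M :
  (forall u, u \in s -> #|` escape L u| <= M)%N ->
  (#|` [fset w in L | has (fun u => (w + u)%R \notin L) s]%fset| <= size s * M)%N.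
Proof.
elim: s => [_|u s IH sM] /=.
  by rewrite leqn0 cardfs_eq0; apply/eqP/fsetP => w; rewrite !inE andbF.
have -> : [fset w in L | ((w + u)%R \notin L) ||
      has (fun u => (w + u)%R \notin L) s]%fset =
    (escape L u `|` [fset w in L | has (fun u => (w + u)%R \notin L) s])%fset.
  by apply/fsetP => w; rewrite in_fsetU !inE -andb_orr.
rewrite cardfsU (leq_trans (leq_subr _ _))// mulSn leq_add ?sM ?inE ?eqxx//.
by apply: IH => v vs; rewrite sM// inE vs orbT.
Qed.

(* A point of L whose tile is not inside L is moved out of L by a translation
   smaller than the tile, and there are finitely many such translations. *)
Lemma card_tile_notin (L : {fset Z2}) :
  (#|` [fset w in L | ~~ (tile (tile_index w) `<=` L)]%fset| <=
   (2 * a * (2 * b) * (a + b)) * perimeter L)%N.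
Proof.
rewrite -mulnA -(card_rect (2 * a) (2 * b) (- a%:Z, - b%:Z)%R).
set Q := rect _ _ _.
apply: leq_trans (@card_has_escape L Q ((a + b) * perimeter L) _); last first.
  move=> [u1 u2] uQ; move: uQ; rewrite in_rect => /and4P[/= ? ? ? ?].
  by apply: escape_le_perimeter => /=; lia.
apply/fsubset_leq_card/fsubsetP => w; rewrite !inE => /andP[-> /fsubsetPn[z zt zL]].
apply/hasP; exists (z - w); last by rewrite addrC subrK.
have : w \in tile (tile_index w) by rewrite mem_tile.
move: zt; rewrite /tile /Q; case: (tile_index w) => t1 t2; case: z w {zL} => z1 z2 [w1 w2].
rewrite !in_rect /= => /and4P[? ? ? ?] /and4P[? ? ? ?].
by apply/and4P; split; lia.
Qed.

(** [T] is the number of tiles inside [L]. The points of [L] in other tiles are bounded in number by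
    the perimeter, and trivially carry at most [N] symbols each. *)
Lemma Gamma_tiling (N : nat) (U : set (config N)) (L : {fset Z2}) :
  (0 < N)%N -> (forall v : Z2, @Defs.shift N v @` U `<=` U) ->
  exists2 T, (T * (a * b) <= #|` L|)%N &
    (Gamma L U <= Gamma (rect a b (0, 0)%R) U ^ T *
       N ^ ((2 * a * (2 * b) * (a + b)) * perimeter L))%N.
Proof.
move=> N0 shiftU.
pose P w := (tile (tile_index w) `<=` L)%fset.
pose s := undup [seq tile_index w | w <- [fset w in L | P w]%fset].
have sP w : w \in L -> (tile_index w \in s) = P w.
  move=> wL; rewrite mem_undup; apply/mapP/idP => [[z + wz]|Pw].
    by rewrite !inE /P wz => /andP[].
  by exists w => //; rewrite !inE wL.
have [||G1 G2] := @Gamma_tiles N U L s shiftU; first exact: undup_uniq.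
  by move=> t; rewrite mem_undup => /mapP[w + ->]; rewrite !inE => /andP[].
exists (size s).
  by rewrite -G2; apply/fsubset_leq_card/fsubsetP => w; rewrite !inE => /andP[].
have LE : L = ([fset w in L | tile_index w \in s] `|` [fset w in L | ~~ P w])%fset.
  apply/fsetP => w; rewrite in_fsetU !inE; case: (boolP (w \in L)) => //= wL.
  by rewrite sP// orbN.
rewrite [in leqLHS]LE (leq_trans (GammaU _ _ _))// leq_mul//.
rewrite (leq_trans (Gamma_le_exp _ _))// leq_pexp2l//.
exact: card_tile_notin.
Qed.

End Tiling.

(** * Logarithmic form of the tiling bound *)

Section LogGamma.
Variables (R : realType) (N : nat) (U : set (config N)).
Hypotheses (N0 : (0 < N)%N) (U0 : U !=set0).
Hypothesis shiftU : forall v : Z2, @Defs.shift N v @` U `<=` U.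

Definition logGamma (L : {fset Z2}) : R := ln (Gamma L U)%:R.

Definition rect_density m n : R := logGamma (rect m n (0, 0)) / (m * n)%:R.

Lemma Gamma_pos L : 0 < (Gamma L U)%:R :> R.
Proof. by rewrite ltr0n Gamma_gt0. Qed.

Lemma logGamma_ge0 L : 0 <= logGamma L.
Proof. by rewrite ln_ge0// ler1n Gamma_gt0. Qed.

Lemma logGammaU L1 L2 :
  logGamma (L1 `|` L2)%fset <= logGamma L1 + logGamma L2.
Proof.
rewrite /logGamma -lnM ?posrE ?Gamma_pos// ler_ln ?posrE ?mulr_gt0 ?Gamma_pos//.
by rewrite -natrM ler_nat GammaU.
Qed.

Lemma logGamma_rect m n v : (0 < m)%N -> (0 < n)%N ->
  logGamma (rect m n v) = (m * n)%:R * rect_density m n.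
Proof.
move=> m0 n0; rewrite /rect_density mulrC divfK ?pnatr_eq0 -?lt0n ?muln_gt0 ?m0//.
by congr (ln _%:R); apply/eqP; rewrite eqn_leq !Gamma_rect_le.
Qed.

Lemma rect_density_ge0 m n : 0 <= rect_density m n.
Proof. by rewrite divr_ge0 ?logGamma_ge0. Qed.

(** The constant [K] depends on the tile and on [N] but not on [L], so the error vanishes relative
    to the size of [L] whenever the perimeter does. *)
Lemma logGamma_tiling a b : (0 < a)%N -> (0 < b)%N ->
  exists2 K : R, 0 <= K & forall L,
    logGamma L <= #|` L|%:R * rect_density a b + K * (perimeter L)%:R.
Proof.
move=> a0 b0; exists ((2 * a * (2 * b) * (a + b))%:R * ln N%:R).
  by rewrite mulr_ge0// ln_ge0// ler1n.
move=> L; have [T TL GT] := Gamma_tiling a0 b0 L N0 shiftU.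
move: GT; set k := (_ * perimeter L)%N => GT.
have NR : 0 < N%:R :> R by rewrite ltr0n.
apply: (@le_trans _ _ (T%:R * logGamma (rect a b (0, 0)) + k%:R * ln N%:R)).
  rewrite /logGamma !mulr_natl -!lnXn ?Gamma_pos//.
  rewrite -lnM ?posrE ?exprn_gt0 ?Gamma_pos//.
  rewrite ler_ln ?posrE ?mulr_gt0 ?exprn_gt0 ?Gamma_pos//.
  by rewrite -!natrX -natrM ler_nat.
rewrite logGamma_rect// mulrA -natrM lerD//.
  by rewrite ler_wpM2r ?rect_density_ge0// ler_nat.
by rewrite [leRHS]mulrAC -natrM.
Qed.

End LogGamma.

(** * Limits superior along a filter *)

Section LimfEsup.
Variables (R : realType) (T : choiceType) (X : filteredType T).
Variables (f : X -> \bar R) (F : set_system X).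
Local Open Scope ereal_scope.

Lemma limf_esup_le_near y :
  (\forall x \near F, f x <= y) -> limf_esup f F <= y.
Proof.
move=> fy; apply: ge_ereal_inf; exists (ereal_sup (f @` [set x | f x <= y])).
  by exists [set x | f x <= y].
by apply: ge_ereal_sup => _ [x ? <-].
Qed.

Lemma limf_esup_ge_near {FF : ProperFilter F} y :
  (\forall x \near F, y <= f x) -> y <= limf_esup f F.
Proof.
move=> fy; apply: le_ereal_inf_tmp => _ [V FV <-].
have [x [Vx yx]] := filter_ex (filterI FV fy).
by apply: le_ereal_sup_tmp; exists (f x) => //; exists x.
Qed.

Lemma limf_esup_lt_near {FF : Filter F} y :
  limf_esup f F < y -> \forall x \near F, f x < y.
Proof.
move=> /ereal_inf_lt[_ [V FV <-] sy]; apply: filterS FV => x Vx.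
by apply: le_lt_trans sy; apply: ereal_sup_ubound; exists x.
Qed.

End LimfEsup.

(** * Upper bound by the infimum of rectangular densities *)

Section EntropyReal.
Variables (R : realType) (N : nat) (U : set (config N)).
Hypotheses (N0 : (0 < N)%N) (U0 : U !=set0).
Hypothesis shiftU : forall v : Z2, @Defs.shift N v @` U `<=` U.

Let densities : set R :=
  [set rect_density R U p.1 p.2 | p in [set p : nat * nat | (0 < p.1)%N /\ (0 < p.2)%N]].

Definition rect_inf : R := inf densities.

Let densities_has_inf : has_inf densities.
Proof.
split; first by exists (rect_density R U 1 1); exists (1%N, 1%N).
by exists 0 => _ [p _ <-]; exact: rect_density_ge0.
Qed.

Lemma rect_inf_le m n : (0 < m)%N -> (0 < n)%N -> rect_inf <= rect_density R U m n.
Proof.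
move=> m0 n0; apply: ge_inf; first by case: densities_has_inf.
by exists (m, n).
Qed.

Lemma rect_inf_adherent (e : R) : 0 < e ->
  exists m n, [/\ (0 < m)%N, (0 < n)%N & rect_density R U m n < rect_inf + e].
Proof.
move=> e0; have [_ [[m n] [/= m0 n0] <-] lt] := inf_adherent e0 densities_has_inf.
by exists m, n.
Qed.

(** Fix one tile of density within [e / 2] of the infimum; the other [e / 2] absorbs the perimeter
    term. A general filter serves both rectangles and expanding systems. *)
Lemma logGamma_le_near (T : Type) (F : set_system T) {FF : Filter F}
    (L : T -> {fset Z2}) :
  (forall e : R, 0 < e ->
     \forall x \near F, (perimeter (L x))%:R <= e * #|` L x|%:R) ->
  forall e : R, 0 < e ->
    \forall x \near F, logGamma R U (L x) <= (rect_inf + e) * #|` L x|%:R.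
Proof.
move=> pL e e0.
have e20 : 0 < e / 2 by rewrite divr_gt0.
have [a [b [a0 b0 ab]]] := rect_inf_adherent e20.
have [K K0 HK] := logGamma_tiling R N0 U0 shiftU a0 b0.
(* [K] may be zero, hence the divisor [K + 1]. *)
have eK0 : 0 < e / 2 / (K + 1) by rewrite divr_gt0// ltr_wpDl.
near=> x.
have px : (perimeter (L x))%:R <= e / 2 / (K + 1) * #|` L x|%:R.
  by near: x; exact: pL.
have Kp : K * (perimeter (L x))%:R <= e / 2 * #|` L x|%:R.
  apply: (@le_trans _ _ ((K + 1) * (perimeter (L x))%:R)).
    by rewrite ler_wpM2r// lerDl.
  rewrite (le_trans (ler_wpM2l _ px)) ?addr_ge0//.
  by rewrite mulrA [_ * (e / 2 / _)]mulrC divfK// gt_eqF// ltr_wpDl.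
rewrite (le_trans (HK _))// (le_trans (lerD (ler_wpM2l _ (ltW ab)) Kp))//.
rewrite mulrC -mulrDl ler_wpM2r//; lra.
Unshelve. all: by end_near. Qed.

Lemma log_densityE L : log_density R U L = (logGamma R U L / #|` L|%:R)%:E.
Proof. by rewrite /log_density lne_EFin ?Gamma_pos// -EFinM mulrC. Qed.

Lemma limf_esup_log_density_le (T : choiceType) (X : filteredType T)
    (F : set_system X) {FF : Filter F} (L : X -> {fset Z2}) :
  (\forall x \near F, L x != fset0) ->
  (forall e : R, 0 < e ->
     \forall x \near F, (perimeter (L x))%:R <= e * #|` L x|%:R) ->
  (limf_esup (fun x => log_density R U (L x)) F <= rect_inf%:E)%E.
Proof.
move=> L0 pL; apply/lee_addgt0Pr => e e0; apply: limf_esup_le_near.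
near=> x; have Lx : L x != fset0 by near: x.
rewrite log_densityE lee_fin ler_pdivrMr ?ltr0n ?cardfs_gt0//.
by near: x; exact: logGamma_le_near pL _ e0.
Unshelve. all: by end_near. Qed.

End EntropyReal.

(** * Rectangular entropy equals the infimum *)

Lemma perimeter_rect_small (R : realType) (e : R) m n v :
  2 <= e * m%:R -> 2 <= e * n%:R ->
  (perimeter (rect m n v))%:R <= e * #|` rect m n v|%:R.
Proof.
move=> em en; rewrite card_rect.
apply: (@le_trans _ _ (m%:R + n%:R)).
  by rewrite -natrD ler_nat perimeter_rect.
(* Multiplying the hypotheses by [n] and [m] bounds [2n] and [2m] by [e m n]; their mean is the
   claim. *)
have hm := ler_wpM2r (ler0n R n) em; have hn := ler_wpM2r (ler0n R m) en.
by rewrite natrM; nra.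
Qed.

Lemma near_rect_large (R : realType) (e : R) : 0 < e ->
  \forall p \near filter_prod \oo \oo,
    2 <= e * (p.1)%:R /\ 2 <= e * (p.2)%:R.
Proof.
move=> e0.
have h : \forall n \near \oo, 2 <= e * n%:R.
  near=> n; rewrite mulrC -ler_pdivrMr//; near: n; exact: nbhs_infty_ger.
by exists ([set n | 2 <= e * n%:R], [set n | 2 <= e * n%:R]).
Unshelve. all: by end_near. Qed.

Lemma near_rect_gt0 :
  \forall p \near filter_prod \oo \oo, (0 < p.1)%N /\ (0 < p.2)%N.
Proof.
by exists ([set n | 0 < n]%N, [set n | 0 < n]%N) => //; split; exact: nbhs_infty_gt.
Qed.

Lemma rect_entropyE (R : realType) (N : nat) (U : set (config N)) :
  rect_entropy R U =
  limf_esup (fun p : nat * nat => log_density R U (rect p.1 p.2 (0, 0)))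
    (filter_prod \oo \oo).
Proof.
congr limf_esup; apply/funext => p.
by rewrite /log_density card_rect.
Qed.

(** The perimeter of a large rectangle is negligible, which gives the upper bound; the lower one
    holds for every rectangle by definition of the infimum. *)
Lemma rect_entropy_inf (R : realType) (N : nat) (U : set (config N)) :
  (0 < N)%N -> U !=set0 -> (forall v : Z2, @Defs.shift N v @` U `<=` U) ->
  rect_entropy R U = (rect_inf R U)%:E.
Proof.
move=> N0 U0 shiftU; rewrite rect_entropyE; apply/eqP; rewrite eq_le; apply/andP; split.
  apply: limf_esup_log_density_le => //.
    apply: filterS near_rect_gt0 => -[m n] /= [m0 n0].
    by rewrite -cardfs_gt0 card_rect muln_gt0 m0.
  move=> e e0; apply: filterS (near_rect_large e0) => -[m n] /= [em en].
  exact: perimeter_rect_small.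
apply: limf_esup_ge_near; apply: filterS near_rect_gt0 => -[m n] /= [m0 n0].
by rewrite log_densityE// lee_fin card_rect; apply: rect_inf_le.
Qed.

Lemma limf_esup_log_density0 (R : realType) (N : nat)
    (T : choiceType) (X : filteredType T)
    (F : set_system X) {FF : Filter F} (L : X -> {fset Z2}) :
  (\forall x \near F, L x != fset0) ->
  limf_esup (fun x => log_density R (@set0 (config N)) (L x)) F = -oo%E.
Proof.
move=> L0; apply/eqP; rewrite -leeNy_eq; apply: limf_esup_le_near.
apply: filterS L0 => x; rewrite -cardfs_gt0 => L0.
by rewrite /log_density Gamma_set0 le0_lneNy// gt0_muleNy// lte_fin invr_gt0 ltr0n.
Qed.

(** * Asymptotics of expanding systems and their hulls *)

Section Expanding.
Variables (R : realType) (Omega : nat -> {fset Z2}).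
Hypothesis hOmega : expanding_system Omega.

Lemma near_expanding_neq0 : \forall n \near \oo, Omega n != fset0.
Proof.
by case: hOmega => O0 _ _; apply: filterS (nbhs_infty_gt 0) => n; exact: O0.
Qed.

Lemma near_expanding_mem v : \forall n \near \oo, v \in Omega n.
Proof.
case: hOmega => _ Om Oc; have [n0 n00 vn0] := Oc v.
apply: filterS (nbhs_infty_ge n0) => n; elim: n => [|n IH].
  by rewrite leqn0 => /eqP n0E; rewrite n0E in n00.
rewrite leq_eqVlt => /predU1P[<-//|]; rewrite ltnS => le_n0n.
by apply: (fsubsetP (Om n _)) (IH le_n0n); exact: leq_trans n00 le_n0n.
Qed.

Lemma near_perimeter_small :
  limn_esup (fun n =>
    ((#|` lattice_boundary (Omega n)|%:R / #|` Omega n|%:R : R)%:E)) = 0%E ->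
  forall e : R, 0 < e ->
  \forall n \near \oo, (perimeter (Omega n))%:R <= e * #|` Omega n|%:R.
Proof.
move=> hbd e e0.
(* Half of [e], because the perimeter is at most twice the boundary. *)
have hlt : (limn_esup (fun n =>
    ((#|` lattice_boundary (Omega n)|%:R / #|` Omega n|%:R : R)%:E)) < (e / 2)%:E)%E.
  by rewrite hbd lte_fin divr_gt0.
near=> n.
have On : 0 < #|` Omega n|%:R :> R.
  by rewrite ltr0n cardfs_gt0; near: n; exact: near_expanding_neq0.
have : (((#|` lattice_boundary (Omega n)|%:R / #|` Omega n|%:R : R)%:E) < (e / 2)%:E)%E.
  by near: n; exact: limf_esup_lt_near hlt.
rewrite lte_fin ltr_pdivrMr// => bn.
apply: (@le_trans _ _ (2 * #|` lattice_boundary (Omega n)|%:R)).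
  by rewrite -natrM ler_nat perimeter_le_boundary.
lra.
Unshelve. all: by end_near. Qed.

(* For n large, Omega n contains the corners of a given square, so both sides of
   its hull tend to infinity. *)
Lemma near_perimeter_hull_small (e : R) : 0 < e ->
  \forall n \near \oo,
    (perimeter (rect_hull (Omega n)))%:R <= e * #|` rect_hull (Omega n)|%:R.
Proof.
move=> e0; pose k := Num.bound (2 / e).
have ek : 2 <= e * k%:R.
  by rewrite mulrC -ler_pdivrMr// ltW// archi_boundP// divr_ge0// ltW.
near=> n.
have On : Omega n != fset0 by near: n; exact: near_expanding_neq0.
have zO : (0, 0) \in Omega n by near: n; exact: near_expanding_mem.
have kO : (k%:Z, k%:Z) \in Omega n by near: n; exact: near_expanding_mem.
have [[a [b [v [_ _ ->]]]] /fsubsetP sub _] := rect_hullP On.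
move: (sub _ zO) (sub _ kO); rewrite !in_rect /= => /and4P[? ? ? ?] /and4P[? ? ? ?].
by apply: perimeter_rect_small; apply: (le_trans ek);
  rewrite ler_pM2l// ler_nat; lia.
Unshelve. all: by end_near. Qed.

End Expanding.

(** * Lower bound through the hull *)

(** Here [x] and [y] are the sizes of [Omega n] and of its complement in the hull; unprimed, primed
    and doubly primed [G] and [p] are log-counts and perimeters of [Omega n], hull and complement;
    [D] is the tile density. Then [G >= r x - (D - r) y - K p''], and each loss is at most
    [e / 2 * x]. *)
Lemma hull_density_bound (R : realFieldType)
    (r C e K D x y G G' G'' p p' p'' : R) :
  0 <= C -> 0 <= K -> 0 < e -> 0 < x -> 0 <= y -> y <= C * x ->
  r <= D -> D < r + e / 2 / (C + 1) ->
  r * (x + y) <= G' -> G' <= G + G'' -> G'' <= y * D + K * p'' ->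
  0 <= p'' -> p'' <= p' + p -> p <= e / 4 / (K + 1) * x ->
  p' <= e / 4 / (K + 1) / (C + 1) * (x + y) ->
  (r - e) * x <= G.
Proof.
move=> C0 K0 e0 x0 y0 Cn D0 Dlt lbH ubH ubC p0 pC pn qn.
have C1 : 0 < C + 1 by rewrite ltr_wpDl.
have K1 : 0 < K + 1 by rewrite ltr_wpDl.
have eps0 : 0 < e / 4 / (K + 1) by rewrite !divr_gt0.
(* The extra factor [C + 1] in the bound on [p'] cancels against [x + y <= (C + 1) x]. *)
have p'x : p' <= e / 4 / (K + 1) * x.
  apply: (le_trans qn); rewrite -[leLHS]mulrA ler_pM2l// ler_pdivrMl//; lra.
have Kp : K * p'' <= e / 2 * x.
  apply: (@le_trans _ _ ((K + 1) * (2 * (e / 4 / (K + 1) * x)))).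
    by apply: ler_pM => //; lra.
  by rewrite le_eqVlt; apply/orP; left; apply/eqP; field; lra.
have Dy : (D - r) * y <= e / 2 * x.
  apply: (@le_trans _ _ (e / 2 / (C + 1) * ((C + 1) * x))).
    by apply: ler_pM => //; lra.
  by rewrite le_eqVlt; apply/orP; left; apply/eqP; field; lra.
lra.
Qed.

Theorem theorem1p1 (R : realType) (N : nat) (hN : (2 <= N)%N)
    (U : set (config N)) (hU : additive_shift_space U)
    (Omega : nat -> {fset Z2}) (hOmega : expanding_system Omega)
    (hbd : limn_esup (fun n =>
        ((#|` lattice_boundary (Omega n)|%:R / #|` Omega n|%:R : R)%:E)) = 0%E) :
  (entropy R Omega U <= rect_entropy R U)%E /\
  ((ereal_sup [set ((#|` rect_compl (Omega n)|%:R / #|` Omega n|%:R : R)%:E)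
                 | n in [set n | (1 <= n)%N]] < +oo)%E ->
   entropy R Omega U = rect_entropy R U).
Proof.
have O0 := near_expanding_neq0 hOmega.
(* For empty [U] both entropies are [-oo]; otherwise every count is positive and logarithms are
   real. *)
have [U0|/set0P U0] := eqVneq U set0.
  have hE : entropy R Omega U = -oo%E.
    by rewrite U0; exact: limf_esup_log_density0.
  have hr : rect_entropy R U = -oo%E.
    rewrite U0 rect_entropyE; apply: limf_esup_log_density0.
    apply: filterS near_rect_gt0 => -[m n] /= [m0 n0].
    by rewrite -cardfs_gt0 card_rect muln_gt0 m0.
  by rewrite hE hr.
have N0 : (0 < N)%N by exact: leq_trans hN.
have [_ shiftU] := hU.
have pO := near_perimeter_small hOmega hbd.
rewrite (rect_entropy_inf R N0 U0 shiftU).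
set r := rect_inf R U.
have le_r : (entropy R Omega U <= r%:E)%E by exact: limf_esup_log_density_le.
split=> // sup_fin; apply/eqP; rewrite eq_le le_r /=.
have [C C0 HC] : exists2 C : R, 0 <= C & forall n, (1 <= n)%N ->
    #|` rect_compl (Omega n)|%:R <= C * #|` Omega n|%:R.
  set S := [set _ | _ in _] in sup_fin.
  have [C supC] : exists C : R, (ereal_sup S <= C%:E)%E.
    case: (ereal_sup S) sup_fin => [C _|//|_]; first by exists C.
    by exists 0; rewrite leNye.
  have SC n : (1 <= n)%N -> #|` rect_compl (Omega n)|%:R / #|` Omega n|%:R <= C.
    by move=> n1; rewrite -lee_fin (le_trans _ supC)// ereal_sup_ubound//; exists n.
  (* The ratio at index 1 is nonnegative, which forces [0 <= C]. *)
  exists C; first by apply: le_trans (SC 1%N isT); rewrite divr_ge0.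
  move=> n n1; rewrite -ler_pdivrMr ?SC// ltr0n cardfs_gt0.
  by case: hOmega => + _ _; apply.
apply/lee_subgt0Pr => e e0.
have C1 : 0 < C + 1 by rewrite ltr_wpDl.
(* Error budget: [e / 2] for the excess density of the tile on the complement, and [e / 4] each for
   the perimeters of [Omega n] and of its hull. *)
have d0 : 0 < e / 2 / (C + 1) by rewrite !divr_gt0.
have [a [b [a0 b0 ab]]] := rect_inf_adherent U0 d0.
have [K K0 HK] := logGamma_tiling R N0 U0 shiftU a0 b0.
have K1 : 0 < K + 1 by rewrite ltr_wpDl.
have eps0 : 0 < e / 4 / (K + 1) by rewrite !divr_gt0.
have eps1 : 0 < e / 4 / (K + 1) / (C + 1) by rewrite divr_gt0.
apply: limf_esup_ge_near; near=> n.
have On : Omega n != fset0 by near: n.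
have On0 : 0 < #|` Omega n|%:R :> R by rewrite ltr0n cardfs_gt0.
rewrite log_densityE// -EFinB lee_fin ler_pdivlMr//.
have pn : (perimeter (Omega n))%:R <= e / 4 / (K + 1) * #|` Omega n|%:R.
  by near: n; exact: pO.
have qn : (perimeter (rect_hull (Omega n)))%:R <=
    e / 4 / (K + 1) / (C + 1) * #|` rect_hull (Omega n)|%:R.
  by near: n; exact: near_perimeter_hull_small.
have Cn : #|` rect_compl (Omega n)|%:R <= C * #|` Omega n|%:R.
  by apply: HC; near: n; exact: nbhs_infty_gt.
have [[m [l [v [m0 l0 hullE]]]] sub _] := rect_hullP On.
have hullU : rect_hull (Omega n) = (Omega n `|` rect_compl (Omega n))%fset.
  by rewrite /rect_compl fsetUDl fsetDv fsetD0 (fsetUidPr _ _ sub).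
have cardH : #|` rect_hull (Omega n)|%:R =
    #|` Omega n|%:R + #|` rect_compl (Omega n)|%:R :> R.
  by rewrite -natrD /rect_compl cardfsDS// subnKC// fsubset_leq_card.
(* The hull is itself a rectangle, so its density is at least the infimum. *)
have lbH : r * #|` rect_hull (Omega n)|%:R <= logGamma R U (rect_hull (Omega n)).
  rewrite hullE card_rect logGamma_rect// mulrC ler_wpM2l//.
  exact: rect_inf_le.
have ubH : logGamma R U (rect_hull (Omega n)) <=
    logGamma R U (Omega n) + logGamma R U (rect_compl (Omega n)).
  by rewrite hullU; exact: logGammaU.
have ubC := HK (rect_compl (Omega n)).
have pC : (perimeter (rect_compl (Omega n)))%:R <=
    (perimeter (rect_hull (Omega n)))%:R + (perimeter (Omega n))%:R :> R.
  by rewrite -natrD ler_nat perimeter_fsetD.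
rewrite cardH in lbH qn.
apply: hull_density_bound C0 K0 e0 On0 _ Cn _ ab lbH ubH ubC _ pC pn qn => //.
exact: rect_inf_le.
Unshelve. all: by end_near. Qed.
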